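(* Let $\mathcal{L}^*$ be the extended long line. Then the topological groups $H_+(\mathcal{L}^* )$ and $H(\mathcal{L}^* )$ are $a$-minimal.
   Context: Let $\omega_1$ be the least uncountable ordinal and let $\mathcal{L}=[0,\omega_1)\times[0,1)$ with the lexicographic order. The extended long line is $\mathcal{L}^*=\mathcal{L}\cup\{\omega_1\}$, with the order of $\mathcal{L}$ extended by $a<\omega_1$ for all $a\in\mathcal{L}$, and equipped with the order topology; it is a compact space. For a compact linearly ordered topological space $X$, $H(X)$ is the group of all homeomorphisms $X\to X$ with the compact-open topology, and $H_+(X)$ is the subgroup of order-preserving homeomorphisms with the subspace topology. A Hausdorff topological group is $a$-minimal if its topology is the smallest Hausdorff group topology on the underlying group (i.e. it is contained in every Hausdorff group topology on that group). *)

(* Defs.v *)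
From HB Require Import structures.
From mathcomp Require Import all_boot all_order all_algebra.
From mathcomp Require Import all_classical wochoice all_reals all_analysis.

Set Implicit Arguments.
Unset Strict Implicit.
Unset Printing Implicit Defensive.

Import Order.TTheory GRing.Theory Num.Theory.

Local Open Scope classical_set_scope.

(* [W] is a copy of [0, omega_1): it is well-ordered and uncountable, and every
   smaller ordinal, i.e. every proper initial segment, is countable. This
   determines [W] up to a unique order isomorphism. *)
Definition is_omega1 d (W : orderType d) : Prop :=
  [/\ well_order (<=%O : rel W), ~ countable [set: W]
    & forall w : W, countable [set x : W | (x < w)%O]].

Section WellOrderType.
Variables (T : choiceType) (r : rel T) (wo : well_order r).

Let wo_min (A : {pred T}) : nonempty A -> exists z, minimum_of r A z.
Proof. by move=> /wo[z [mz _]]; exists z. Qed.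

Let wo_total : total r.
Proof.
move=> x y; have /wo_min[z] : nonempty (pred2 x y).
  by exists x; rewrite !inE eqxx.
move=> -[]; rewrite !inE => /orP[]/eqP -> lb.
  by rewrite lb// !inE eqxx orbT.
by rewrite orbC lb// !inE eqxx.
Qed.

Let wo_refl : reflexive r.
Proof. by move=> x; have /orP[] := wo_total x x. Qed.

Lemma wo_anti : antisymmetric r.
Proof.
move=> x y /andP[xy yx]; have [|z [_ zu]] := wo (A := pred2 x y).
  by exists x; rewrite !inE eqxx.
have <- : z = x.
  by apply: zu; split=> [|t]; rewrite !inE ?eqxx// => /orP[]/eqP->.
by apply: zu; split=> [|t]; rewrite !inE ?eqxx ?orbT// => /orP[]/eqP->.
Qed.

Lemma wo_trans : transitive r.
Proof.
move=> y x z xy yz; have /wo_min[m] : nonempty (pred3 x y z).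
  by exists x; rewrite !inE eqxx.
move=> -[]; rewrite !inE => /or3P[]/eqP -> lb.
- by rewrite lb// !inE eqxx !orbT.
- suff -> : x = y by [].
  by apply/wo_anti; rewrite xy lb// !inE eqxx.
- have zx : r z x by rewrite lb// !inE eqxx.
  have zy : r z y by rewrite lb// !inE eqxx orbT.
  by have <- : y = z by apply/wo_anti; rewrite yz zy.
Qed.

Definition wo_type of well_order r : Type := T.
Local Notation wT := (wo_type wo).
HB.instance Definition _ := Choice.on wT.
HB.instance Definition _ := @Order.Le_isPOrder.Build Order.default_display wT r
  wo_refl wo_anti wo_trans.
HB.instance Definition _ := Order.POrder_isTotal.Build _ wT wo_total.

End WellOrderType.

Lemma omega1_exists : exists d (W : orderType d), is_omega1 W.
Proof.
pose T : choiceType := set nat.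
have ncT : ~ countable [set: T].
  move=> /countable_injP[f fI].
  pose D : T := [set n | exists2 A : T, f A = n & ~ A n].
  have nDf : ~ D (f D).
    by move=> /[dup] Df [A /fI]; rewrite !inE => -> //; apply.
  by apply: (nDf); exists D.
have [r wo] := well_ordering_principle T.
pose seg (w : T) := [set x : T | r x w && (x != w)].
have rtrans := wo_trans wo; have ranti := wo_anti wo.
have [P [ncP cP]] : exists P : pred T, ~ countable [set x | P x] /\
    forall w, P w -> countable (seg w).
  have [[w0 nc0]|h] := pselect (exists w, ~ countable (seg w)); last first.
    exists predT; split=> [|w _].
      by rewrite (_ : [set x | _] = setT)//; apply/seteqP; split.
    by apply: contrapT => ncw; apply: h; exists w.
  pose A := [pred w : T | `[< ~ countable (seg w) >]].
  have [|m [[/asboolP mA mlb] mu]] := wo A.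
    by exists w0; apply/asboolP.
  exists [pred x | r x m && (x != m)]; split=> // w /andP[wm wNm].
  apply: contrapT => ncw; move/eqP: wNm; apply; apply: ranti.
  by rewrite wm mlb//; apply/asboolP.
have woP : well_order (relpre val r : rel {x | P x}).
  apply: antisymmetric_well_order => [x y /ranti/val_inj//|B [b bB]].
  have [|m [[/asboolP[z [zB zm]] mlb] _]] :=
    wo [pred x | `[< exists z, z \in B /\ val z = x >]].
    by exists (val b); apply/asboolP; exists b.
  exists z; split=> // x xB; rewrite /= zm; apply: mlb.
  by apply/asboolP; exists x.
exists _, (wo_type woP : orderType _); split.
- exact: woP.
- move=> /countable_injP[f fI]; apply: ncP; apply/countable_injP.
  exists (fun x => if insub x is Some y then f (y : wo_type woP) else 0).
  move=> x y; rewrite !inE /= => Px Py; rewrite !insubT /=.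
  by move=> /(fI _ _ (mem_setT _) (mem_setT _)) [].
- move=> w; have /countable_injP[f fI] := cP _ (valP w).
  apply/countable_injP; exists (fun x => f (val x)) => x y xw yw.
  have segw z : z \in [set x : wo_type woP | (x < w)%O] -> val z \in seg (val w).
    by rewrite !inE /= lt_neqAle => /andP[zw zr]; apply/andP; split.
  by move=> /(fI _ _ (segw _ xw) (segw _ yw)) /val_inj.
Qed.

Definition unit_Ico (R : realType) : Type := {x : R | (0 <= x < 1)%R}.

HB.instance Definition _ (R : realType) := SubChoice.on (unit_Ico R).
HB.instance Definition _ (R : realType) :=
  [SubChoice_isSubOrder of unit_Ico R by <: with ring_display].

(* [None] is the new greatest element. *)
Definition with_top (T : Type) : Type := option T.

Section WithTop.
Variables (d : Order.disp_t) (T : orderType d).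

Definition with_top_le (x y : with_top T) : bool :=
  match x, y with
  | _, None => true
  | None, Some _ => false
  | Some a, Some b => (a <= b)%O
  end.

Lemma with_top_le_refl : reflexive with_top_le.
Proof. by case=> [a|] /=. Qed.

Lemma with_top_le_anti : antisymmetric with_top_le.
Proof. by move=> [a|] [b|] //= /le_anti ->. Qed.

Lemma with_top_le_trans : transitive with_top_le.
Proof. by move=> [a|] [b|] [c|] //=; exact: le_trans. Qed.

Lemma with_top_le_total : total with_top_le.
Proof. by move=> [a|] [b|] //=; exact: le_total. Qed.

HB.instance Definition _ := Choice.on (with_top T).
HB.instance Definition _ := @Order.Le_isPOrder.Build d (with_top T) with_top_le
  with_top_le_refl with_top_le_anti with_top_le_trans.
HB.instance Definition _ :=
  Order.POrder_isTotal.Build d (with_top T) with_top_le_total.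

End WithTop.

(* [*l] is the lexicographic product. *)
Definition long_line d (W : orderType d) (R : realType) : orderType _ :=
  W *l unit_Ico R.

Definition extended_long_line d (W : orderType d) (R : realType) :
    orderTopologicalType _ :=
  order_topology (with_top (long_line W R)).

(* No compatibility between the group operations and the topology is assumed. *)
#[short(type="preTopologicalGroupType")]
HB.structure Definition PreTopologicalGroup := {G of Group G & Topological G}.

Definition homeomorphism (X : topologicalType) (f : X -> X) : Prop :=
  continuous f /\ exists g, [/\ continuous g, cancel f g & cancel g f].

Record homeo (X : topologicalType) := Homeo {
  homeo_fun :> X -> X;
  homeo_subproof : `[< homeomorphism homeo_fun >]
}.

HB.instance Definition _ (X : topologicalType) :=
  [isSub for @homeo_fun X].
HB.instance Definition _ (X : topologicalType) := [Choice of homeo X by <:].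

Section HomeoGroup.
Variable X : topologicalType.
Implicit Types f g h : homeo X.

Lemma homeoP f : homeomorphism f.
Proof. by apply/asboolP; case: f. Qed.

Lemma homeo_inv_ex f : exists g : homeo X, cancel f g /\ cancel g f.
Proof.
have [fc [g [gc fg gf]]] := homeoP f.
have gP : `[< homeomorphism g >] by apply/asboolP; split=> //; exists f.
by exists (Homeo gP).
Qed.

Definition homeo_inv f : homeo X := projT1 (cid (homeo_inv_ex f)).

Lemma homeoK f : cancel f (homeo_inv f).
Proof. by rewrite /homeo_inv; case: cid => g []. Qed.

Lemma homeoVK f : cancel (homeo_inv f) f.
Proof. by rewrite /homeo_inv; case: cid => g []. Qed.

Lemma homeo_one_subproof : `[< homeomorphism (@id X) >].
Proof. by apply/asboolP; split=> [x|]; [|exists id; split=> // x]. Qed.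

Definition homeo_one : homeo X := Homeo homeo_one_subproof.

Lemma homeo_mul_subproof f g : `[< homeomorphism (f \o g) >].
Proof.
apply/asboolP; have [[fc [f' [f'c fK f'K]]] [gc [g' [g'c gK g'K]]]] :=
  (homeoP f, homeoP g).
split; first by move=> x; apply: continuous_comp; [exact: gc|exact: fc].
exists (g' \o f'); split; [|exact: can_comp|exact: can_comp].
by move=> x; apply: continuous_comp; [exact: f'c|exact: g'c].
Qed.

Definition homeo_mul f g : homeo X := Homeo (homeo_mul_subproof f g).

Lemma homeo_mulA : associative homeo_mul.
Proof. by move=> f g h; exact: val_inj. Qed.

Lemma homeo_mul1 : left_id homeo_one homeo_mul.
Proof. by move=> f; exact: val_inj. Qed.

Lemma homeo_mulr1 : right_id homeo_one homeo_mul.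
Proof. by move=> f; exact: val_inj. Qed.

Lemma homeo_mulV : left_inverse homeo_one homeo_inv homeo_mul.
Proof. by move=> f; apply/val_inj/funext => x; exact: homeoK. Qed.

Lemma homeo_mulrV : right_inverse homeo_one homeo_inv homeo_mul.
Proof. by move=> f; apply/val_inj/funext => x; exact: homeoVK. Qed.

HB.instance Definition _ := isGroup.Build (homeo X)
  homeo_mulA homeo_mul1 homeo_mulr1 homeo_mulV homeo_mulrV.

HB.instance Definition _ := Topological.copy (homeo X)
  (initial_topology (@homeo_fun X : homeo X -> {compact-open, X -> X})).

End HomeoGroup.

Section OrderHomeoGroup.
Variables (d : Order.disp_t) (X : orderTopologicalType d).

Definition order_preserving : pred (homeo X) :=
  fun f => `[< {homo f : x y / (x <= y)%O} >].

Record order_homeo := OrderHomeo {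
  order_homeo_val :> homeo X;
  order_homeo_subproof : order_preserving order_homeo_val
}.

HB.instance Definition _ := [isSub for order_homeo_val].
HB.instance Definition _ := [Choice of order_homeo by <:].

Lemma order_preserving_group_closed : group_closed order_preserving.
Proof.
split=> [|f g /asboolP fP /asboolP gP]; first exact/asboolP.
apply/asboolP => x y xy; apply: fP; rewrite leNgt; apply/negP => yx.
have /= := gP _ _ (ltW yx); rewrite !homeoVK => /(conj xy)/andP/le_anti xyE.
by rewrite xyE ltxx in yx.
Qed.

HB.instance Definition _ :=
  SubChoice_isSubGroup.Build _ _ order_homeo order_preserving_group_closed.

HB.instance Definition _ := Topological.copy order_homeo
  (initial_topology order_homeo_val).

End OrderHomeoGroup.

(* A topology on [G] is given by its class [tau]; [Topological.Pack tau] is [G]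
   equipped with that topology. *)
Definition group_topology (G : groupType) (tau : Topological G) : Prop :=
  let T := Topological.Pack tau in
  continuous (fun xy : T * T => (xy.1 * xy.2)%g : T) /\
  continuous (fun x : T => (x^-1)%g : T).

Definition hausdorff_group_topology (G : groupType) (tau : Topological G) :
    Prop :=
  group_topology tau /\ hausdorff_space (Topological.Pack tau).

Definition a_minimal (G : preTopologicalGroupType) : Prop :=
  hausdorff_group_topology (Topological.on G) /\
  forall tau : Topological G, hausdorff_group_topology tau ->
    @open G `<=` @open (Topological.Pack tau).

(* Main.v *)
(* The evaluation map of a group G of order-preserving homeomorphisms of a
   densely ordered space X is jointly continuous as soon as all sets
   {g | a < g x} and {g | g x < b} are open; such a topology therefore contains
   the compact-open one, which itself has these open sets. If T is a Hausdorff
   group topology on G, then a set {g | [g h g^-1, k] <> 1} is T-open. When h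
   is supported in (-oo, x) and k in (a, +oo), such a g satisfies a < g x, since
   otherwise g h g^-1 and k have disjoint supports; conversely, if a < g x, then
   non-commuting elements supported in (a, g x) provide such h and k. So
   {g | a < g x} is a union of T-open sets, and the sets {g | g x < b} follow by
   inversion.

   In the extended long line, non-commuting elements live on a fibre
   {w} x [0, 1). Every homeomorphism f fixes the top point, the only point that
   is not the limit of a sequence of other points, and then f preserves the
   order: if x < y and f y < f x, the intermediate value theorem on
   [y, omega_1] contradicts injectivity. Hence H = H_+. *)

Require Import Defs.
From mathcomp Require Import all_boot all_order all_algebra.
From mathcomp Require Import all_classical wochoice all_reals all_analysis.
From mathcomp Require Import lra.

Set Implicit Arguments.
Unset Strict Implicit.
Unset Printing Implicit Defensive.

Import Order.TTheory GRing.Theory Num.Theory.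

Local Open Scope classical_set_scope.
Local Open Scope order_scope.

(** * Order topologies, currying and joint continuity *)

Lemma order_cvgP d (X : orderTopologicalType d) (F : set_system X) (p : X) :
  Filter F ->
  F --> p <-> (forall a, a < p -> F [set y | a < y]) /\
              (forall b, p < b -> F [set y | y < b]).
Proof.
move=> FF; split=> [Fp|[Fl Fr]].
  split=> [a ap|b pb]; apply: Fp.
    have := open_nbhs_nbhs
      (conj (rray_open a) _ : open_nbhs p `]a, +oo[%classic).
    rewrite set_itvE; exact.
  have := open_nbhs_nbhs (conj (lray_open b) _ : open_nbhs p `]-oo, b[%classic).
  by rewrite set_itvE; exact.
move=> A; rewrite itv_nbhsE => -[i [io pi] iA]; apply: filterS iA _.
case: i io pi => [[[]a|[]] [[]b|[]]] //= _.
- rewrite in_itv /= => /andP[ap pb].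
  apply: filterS (filterI (Fl _ ap) (Fr _ pb)) => y [ay yb].
  by rewrite /= in_itv /=; apply/andP.
- rewrite in_itv /= andbT => ap.
  by apply: filterS (Fl _ ap) => y ay; rewrite /= in_itv /= andbT.
- rewrite in_itv /= => pb.
  by apply: filterS (Fr _ pb) => y yb; rewrite /= in_itv.
- by move=> _; apply: filterS filterT => y _; rewrite /= in_itv.
Qed.

Lemma order_nbhs_gt d (X : orderTopologicalType d) (a p : X) :
  a < p -> \forall y \near p, a < y.
Proof. by have [+ _] := (order_cvgP p _).1 cvg_id; exact. Qed.

Lemma order_nbhs_lt d (X : orderTopologicalType d) (b p : X) :
  p < b -> \forall y \near p, y < b.
Proof. by have [_ +] := (order_cvgP p _).1 cvg_id; exact. Qed.

(** Tube lemma: compactness of [K] merges the neighbourhoods of [t] found at each point of [K] into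
    one. *)
Lemma curry_compact_open_continuous (T X Y : topologicalType)
    (e : T -> X -> Y) :
  continuous (fun xt : X * T => e xt.2 xt.1) ->
  continuous (e : T -> {compact-open, X -> Y}).
Proof.
move=> ec t; apply/compact_open_cvgP => K O cK oO eKO.
have : \forall t' \near t, K `<=` [set x | O (e t' x)].
  move/compact_near_coveringP : cK; apply => x Kx.
  have Oex : nbhs (e t x) O.
    by apply: open_nbhs_nbhs; split=> //; apply: eKO; exists x.
  exact: (ec (x, t) _ Oex).
by apply: filterS => t' KO _ [x Kx <-]; exact: KO.
Qed.

(** If [a < e t x], density and surjectivity give [y < x] with [a < e t y]. By monotonicity the
    single condition [a < e t' y] then controls all [x' > y]; upper bounds are symmetric. *)
Lemma jointly_continuous_of_open_rays d (X : orderTopologicalType d)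
    (T : topologicalType) (e : T -> X -> X) :
  (forall x y : X, x < y -> exists2 z, x < z & z < y) ->
  (forall t, {homo e t : x y / x <= y}) ->
  (forall t y, exists x, e t x = y) ->
  (forall a x, open [set t | a < e t x]) ->
  (forall b x, open [set t | e t x < b]) ->
  continuous (fun xt : X * T => e xt.2 xt.1).
Proof.
move=> dense mono surj ol orr [x t]; apply/order_cvgP => /=.
split=> [a ax|b xb].
  have [m am mx] := dense _ _ ax; have [y ym] := surj t m.
  have yx : y < x.
    by rewrite ltNge; apply/negP => /(mono t); rewrite ym leNgt mx.
  exists ([set x' | y < x'], [set t' | a < e t' y]) => /=.
    split; first exact: order_nbhs_gt.
    by apply: open_nbhs_nbhs; split; [exact: ol|rewrite /= ym].
  move=> [x' t'] /= [yx' at']; exact: lt_le_trans at' (mono _ _ _ (ltW yx')).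
have [m xm mb] := dense _ _ xb; have [y ym] := surj t m.
have xy : x < y by rewrite ltNge; apply/negP => /(mono t); rewrite ym leNgt xm.
exists ([set x' | x' < y], [set t' | e t' y < b]) => /=.
  split; first exact: order_nbhs_lt.
  by apply: open_nbhs_nbhs; split; [exact: orr|rewrite /= ym].
by move=> [x' t'] /= [yx' at']; exact: le_lt_trans (mono _ _ _ (ltW yx')) at'.
Qed.

Lemma open_neq (T S : topologicalType) (u v : T -> S) : hausdorff_space S ->
  continuous u -> continuous v -> open [set t | u t <> v t].
Proof.
rewrite open_hausdorff => S2 uc vc; rewrite openE => t /= /eqP /S2 {S2}.
move=> [[A B] /= [/set_mem At /set_mem Bt] [oA oB /eqP /= AB0]].
have nA : \forall t' \near t, A (u t') by apply: uc; exact: open_nbhs_nbhs.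
have nB : \forall t' \near t, B (v t') by apply: vc; exact: open_nbhs_nbhs.
apply: filterS (filterI nA nB) => t' /= [At' Bt'] uv.
suff : set0 (u t') by [].
by rewrite -AB0; split=> //; rewrite uv.
Qed.

(** * Minimality for groups acting by order automorphisms *)

Section OrderAction.
Context d (X : orderTopologicalType d) (G : groupType) (e : G -> X -> X).
Hypothesis dense : forall x y : X, x < y -> exists2 z, x < z & z < y.
Hypothesis e1 : e 1%g = id.
Hypothesis eM : forall g h, e (g * h)%g = e g \o e h.
Hypothesis e_inj : injective e.
Hypothesis e_mono : forall g, {homo e g : x y / x <= y}.

Lemma act_invK g : cancel (e g) (e g^-1%g).
Proof. by move=> x; rewrite -[LHS]/((e _ \o e g) x) -eM mulVg e1. Qed.

Lemma act_invVK g : cancel (e g^-1%g) (e g).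
Proof. by move=> x; rewrite -[LHS]/((e g \o e _) x) -eM mulgV e1. Qed.

Lemma act_lt g : {mono e g : x y / x < y}.
Proof.
apply: leW_mono => x y; apply/idP/idP; last exact: e_mono.
by move/(e_mono g^-1%g); rewrite !act_invK.
Qed.

Lemma act_ltV g a x : (e g^-1%g a < x) = (a < e g x).
Proof. by rewrite -(act_lt g) act_invVK. Qed.

Lemma act_Vlt g a x : (x < e g^-1%g a) = (e g x < a).
Proof. by rewrite -(act_lt g) act_invVK. Qed.

Section Topology.
Variable tau : Topological G.
Let T : topologicalType := Topological.Pack tau.

Lemma act_jointly_continuous :
  (forall a x, open [set g : T | a < e g x]) ->
  (forall b x, open [set g : T | e g x < b]) ->
  continuous (fun xg : X * T => e xg.2 xg.1).
Proof.
apply: (@jointly_continuous_of_open_rays _ X T e) => // g y.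
by exists (e g^-1%g y); exact: act_invVK.
Qed.

(** [tau] is the initial topology along [e], phrased so as to cover both [homeo] and its
    subgroup. *)
Hypothesis tauE : forall A : set T,
  open A <-> exists2 B : set {compact-open, X -> X}, open B & e @^-1` B = A.

Lemma compact_open_lray a x : open [set g : T | a < e g x].
Proof.
apply/tauE.
exists [set f : {compact-open, X -> X} | f @` [set x] `<=` `]a, +oo[%classic].
  by apply: compact_open_open; [exact: compact_set1|exact: rray_open].
by apply/seteqP; split=> g /=; rewrite image_set1 set_itvE sub1set inE.
Qed.

Lemma compact_open_rray b x : open [set g : T | e g x < b].
Proof.
apply/tauE.
exists [set f : {compact-open, X -> X} | f @` [set x] `<=` `]-oo, b[%classic].
  by apply: compact_open_open; [exact: compact_set1|exact: lray_open].
by apply/seteqP; split=> g /=; rewrite image_set1 set_itvE sub1set inE.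
Qed.

Lemma compact_open_act_continuous : continuous (fun xg : X * T => e xg.2 xg.1).
Proof.
apply: act_jointly_continuous.
  exact: compact_open_lray.
exact: compact_open_rray.
Qed.

Lemma compact_open_continuous (S : topologicalType) (f : S -> T) :
  continuous (fun xs : X * S => e (f xs.2) xs.1) -> continuous f.
Proof.
move=> /(curry_compact_open_continuous (e := e \o f)) /continuousP efc.
by apply/continuousP => A /tauE[B oB <-]; exact: efc.
Qed.

(** After uncurrying, multiplication is a composite of two evaluations, and inversion exchanges the
    two kinds of open ray conditions. *)
Lemma compact_open_group_topology : group_topology tau.
Proof.
split.
  apply: (@compact_open_continuous (T * T)%type).
  have -> : (fun xs : X * (T * T) => e (xs.2.1 * xs.2.2)%g xs.1) =
      (fun xg : X * T => e xg.2 xg.1) \o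
      (fun xs : X * (T * T) => (e xs.2.2 xs.1, xs.2.1)).
    by apply/funext => xs /=; rewrite eM.
  move=> xs; apply: continuous_comp; last exact: compact_open_act_continuous.
  apply: cvg_pair => /=; last by apply: (cvg_comp _ _ cvg_snd); exact: cvg_fst.
  apply: (@continuous_comp _ _ _ (fun xs : X * (T * T) => (xs.1, xs.2.2))
    (fun xg : X * T => e xg.2 xg.1)); last exact: compact_open_act_continuous.
  apply: cvg_pair => /=; first exact: cvg_fst.
  by apply: (cvg_comp _ _ cvg_snd); exact: cvg_snd.
apply: (@compact_open_continuous T).
apply: (@jointly_continuous_of_open_rays _ X T (fun g => e g^-1%g)) => //.
- by move=> g y; exists (e g y); exact: act_invK.
- move=> a x; under eq_set do rewrite act_Vlt; exact: compact_open_rray.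
- move=> a x; under eq_set do rewrite act_ltV; exact: compact_open_lray.
Qed.

(** Evaluation at each [x] is continuous into the Hausdorff space [X], so inseparable elements agree
    at every point. *)
Lemma compact_open_hausdorff : hausdorff_space T.
Proof.
have ec x : continuous (fun g : T => e g x).
  move=> g; apply: (@continuous_comp _ _ _ (fun g : T => (x, g))
    (fun xg : X * T => e xg.2 xg.1)); last exact: compact_open_act_continuous.
  by apply: cvg_pair; [exact: cvg_cst|exact: cvg_id].
move=> g h gh; apply: e_inj; apply/funext => x.
apply: (@order_hausdorff _ X) => A B /ec nA /ec nB.
by have [k [Ak Bk]] := gh _ _ nA nB; exists (e k x).
Qed.

End Topology.

Section Minimality.
Hypothesis rich : forall p q : X, p < q -> exists h k : G,
  [/\ h * k <> k * h, (forall x, ~~ (p < x < q) -> e h x = x)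
    & (forall x, ~~ (p < x < q) -> e k x = x)]%g.

Lemma lray_commutatorsE a x :
  [set g | a < e g x] = \bigcup_(hk in [set hk : G * G |
      (forall y, x <= y -> e hk.1 y = y) /\ (forall y, y <= a -> e hk.2 y = y)])
    [set g | g * hk.1 * g^-1 * hk.2 <> hk.2 * (g * hk.1 * g^-1)]%g.
Proof.
apply/seteqP; split=> [g /= agx|g [[h k] /= [hx ka]] ncomm].
  have [h [k [hk hfix kfix]]] := rich agx.
  (* Conjugating by [g^-1] moves the support of [h] from [(a, g x)] to below [x]; conjugating back
     by [g] returns [h] itself. *)
  exists (g^-1 * h * g, k)%g => /=; last first.
    by rewrite (_ : g * _ * _ = h)%g// !mulgA mulgV mul1g mulgK.
  split=> y yx; last by apply: kfix; rewrite negb_and -!leNgt yx.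
  by rewrite !eM /= hfix ?act_invK// negb_and -!leNgt (e_mono g yx) orbT.
(* If [g x <= a], then [g h g^-1] moves only points below [a] and [k] only points above [a]. Each
   preserves its own half-line, so they commute. *)
rewrite ltNge; apply/negP => gxa; apply: ncomm; apply: e_inj; apply/funext => y.
rewrite !eM /=; have [ya|/ltW ay] := leP y a.
  rewrite (ka y ya) ka//; have [xy|/ltW yx] := leP x (e g^-1%g y).
    by rewrite hx// act_invVK.
  apply: le_trans gxa; apply: e_mono; rewrite -[leRHS](hx x (lexx x)).
  exact: e_mono.
have fixg z : a <= z -> e g (e h (e g^-1%g z)) = z.
  move=> az; rewrite hx ?act_invVK// -(act_invK g x).
  by apply: e_mono; exact: le_trans az.
by rewrite !fixg// -(ka a (lexx a)); exact: e_mono.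
Qed.

Lemma hausdorff_group_open_lray (tau : Topological G) a x :
  hausdorff_group_topology tau ->
  open ([set g | a < e g x] : set (Topological.Pack tau)).
Proof.
set T := Topological.Pack tau => -[[mulc invc] T2].
have mulc2 (u v : T -> T) : continuous u -> continuous v ->
    continuous (fun g => (u g * v g)%g : T).
  move=> uc vc g; apply: (@continuous_comp _ _ _ (fun g => (u g, v g))
    (fun gh : T * T => (gh.1 * gh.2)%g : T)); last exact: mulc.
  by apply: cvg_pair; [exact: uc|exact: vc].
have cstc (c : T) : continuous (fun _ : T => c) by move=> g; exact: cvg_cst.
rewrite lray_commutatorsE; apply: bigcup_open => -[h k] _ /=.
have conjc : continuous (fun g : T => (g * h * g^-1)%g : T).
  by apply: (mulc2) => //; apply: (mulc2) => // g; exact: cvg_id.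
by apply: (@open_neq T T (fun g => g * h * g^-1 * k)%g
  (fun g => k * (g * h * g^-1))%g) => //; exact: mulc2.
Qed.

Lemma hausdorff_group_open_rray (tau : Topological G) b x :
  hausdorff_group_topology tau ->
  open ([set g | e g x < b] : set (Topological.Pack tau)).
Proof.
move=> tauP; have [[_ /continuousP invc] _] := tauP.
have := invc _ (hausdorff_group_open_lray x b tauP).
by rewrite /preimage /=; under eq_set do rewrite act_Vlt.
Qed.

Lemma order_action_minimal (tau : Topological G) :
  (forall A : set (Topological.Pack tau), open A <->
    exists2 B : set {compact-open, X -> X}, open B & e @^-1` B = A) ->
  hausdorff_group_topology tau /\
  forall sigma : Topological G, hausdorff_group_topology sigma ->
    @open (Topological.Pack tau) `<=` @open (Topological.Pack sigma).
Proof.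
move=> tauE; split; first split.
- exact: compact_open_group_topology.
- exact: compact_open_hausdorff.
move=> sigma sigmaP A /tauE[B oB <-].
have /curry_compact_open_continuous/continuousP : continuous
    (fun xg : X * (Topological.Pack sigma) => e xg.2 xg.1).
  apply: act_jointly_continuous => c x; first exact: hausdorff_group_open_lray.
  exact: hausdorff_group_open_rray.
exact.
Qed.

End Minimality.
End OrderAction.

(** * Order and bump homeomorphisms on the extended long line *)

Local Notation X W R := (extended_long_line W R).

Lemma long_le d (W : orderType d) (R : realType) (v w : W) (s t : unit_Ico R) :
  (Some (v, s) <= Some (w, t) :> X W R) =
  (v < w) || (v == w) && (val s <= val t)%R.
Proof.
rewrite -[LHS]/(((v, s) : long_line W R) <= (w, t)) lexi_pair -leEsub.
by case: ltgtP.
Qed.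

Lemma long_lt d (W : orderType d) (R : realType) (v w : W) (s t : unit_Ico R) :
  (Some (v, s) < Some (w, t) :> X W R) =
  (v < w) || (v == w) && (val s < val t)%R.
Proof.
rewrite (@ltNge _ (X W R)) long_le negb_or negb_and -leNgt -ltNge.
by case: (ltgtP v w).
Qed.

Lemma long_leT d (W : orderType d) (R : realType) (x : X W R) : x <= None.
Proof. by case: x. Qed.

Lemma long_ltT d (W : orderType d) (R : realType) x : (Some x < None :> X W R).
Proof. by rewrite (@lt_neqAle _ (X W R)) long_leT. Qed.

(** Use the fibre of [x] above its second coordinate [s], up to the second coordinate of [y] if [y]
    lies on that fibre, and up to 1 otherwise. *)
Lemma long_line_fiber_in_itv d (W : orderType d) (R : realType) (x y : X W R) :
  x < y -> exists w (s t : R), [/\ (0 <= s)%R, (s < t)%R, (t <= 1)%R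
    & forall u : unit_Ico R, (s < val u < t)%R ->
      x < (Some (w, u) : X W R) < y].
Proof.
case: x => [[w [s s01]]|]; last by rewrite (@ltNge _ (X W R)) long_leT.
have /andP[s0 s1] := s01.
have below1 (z : X W R) : (forall u, (Some (w, u) : X W R) < z) ->
    exists w' (s' t : R), [/\ (0 <= s')%R, (s' < t)%R, (t <= 1)%R
    & forall u : unit_Ico R, (s' < val u < t)%R ->
      (Some (w, exist _ s s01) : X W R) < (Some (w', u) : X W R) < z].
  move=> wz; exists w, s, 1%R; split=> // u /andP[su _].
  by rewrite wz long_lt eqxx su orbT.
case: y => [[v [t t01]]|_]; last by apply: below1 => u; exact: long_ltT.
rewrite long_lt => /orP[wv|/andP[/eqP <- /= st]].
  by apply: below1 => u; rewrite long_lt wv.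
have /andP[t0 t1] := t01.
exists w, s, t; split=> //; first exact: ltW.
by move=> u /andP[su ut]; rewrite !long_lt eqxx /= su ut !orbT.
Qed.

Lemma long_line_dense d (W : orderType d) (R : realType) (x y : X W R) :
  x < y -> exists2 z, x < z & z < y.
Proof.
move=> /long_line_fiber_in_itv[w [s [t [s0 st t1 itv]]]].
have m01 : (0 <= (s + t) / 2 < 1)%R by apply/andP; split; lra.
pose m : unit_Ico R := Sub ((s + t) / 2)%R m01.
have /andP[xz zy] : x < (Some (w, m) : X W R) < y.
  by apply: itv; rewrite SubK; apply/andP; split; lra.
by exists (Some (w, m)).
Qed.

Lemma order_iso_homeomorphism d (Y : orderTopologicalType d) (f g : Y -> Y) :
  {homo f : x y / x <= y} -> {homo g : x y / x <= y} -> cancel f g ->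
  cancel g f -> homeomorphism f.
Proof.
have cont h k : {homo h : x y / x <= y} -> {homo k : x y / x <= y} ->
    cancel h k -> cancel k h -> continuous (h : Y -> Y).
  move=> hm km hK kK x.
  have hlt : {mono h : y z / y < z}.
    apply: leW_mono => y z; apply/idP/idP => [|/hm//].
    by move=> /km; rewrite !hK.
  apply/order_cvgP; split=> a.
    rewrite -{1}(kK a) hlt => /order_nbhs_gt.
    by apply: filterS => y; rewrite -hlt kK.
  rewrite -{1}(kK a) hlt => /order_nbhs_lt.
  by apply: filterS => y; rewrite -hlt kK.
move=> fm gm fK gK; split; first exact: cont gK.
by exists g; split=> //; exact: cont fK.
Qed.

Section Bump.
Context d (W : orderType d) (R : realType).
Local Notation I := (unit_Ico R).
Implicit Types (w : W) (u : I).

Definition on_fiber w (phi : I -> I) (x : X W R) : X W R :=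
  if x is Some (v, u) then Some (v, if v == w then phi u else u) else None.

Lemma on_fiber_homo w phi : {homo phi : u u' / u <= u'} ->
  {homo on_fiber w phi : x y / x <= y}.
Proof.
move=> hphi [[v s]|] [[v' s']|] //=; rewrite !long_le.
by case: (ltgtP v v') => //= <-; case: ifP => // _; exact: hphi.
Qed.

Lemma on_fiberK w phi psi : cancel phi psi ->
  cancel (on_fiber w phi) (on_fiber w psi).
Proof. by move=> K [[v s]|] //=; case: eqP => // _; rewrite K. Qed.

(* The identity off [s, t], and piecewise linear with slopes 2 and 1/2 on it.
   [bump_down] is its inverse. The default value of [insubd] is never used when
   0 <= s < t <= 1. *)
Definition bump_up (s t : R) u : I :=
  insubd u (Num.max (val u) (Num.min (2 * val u - s) ((val u + t) / 2)))%R.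

Definition bump_down (s t : R) u : I :=
  insubd u (Num.min (val u) (Num.max ((val u + s) / 2) (2 * val u - t)))%R.

Variables s t : R.
Hypothesis stI : (0 <= s /\ s < t /\ t <= 1)%R.

Lemma val_bump_up u : val (bump_up s t u) =
  Num.max (val u) (Num.min (2 * val u - s) ((val u + t) / 2))%R.
Proof.
have [s0 [st t1]] := stI.
suff bnd (x : R) : (0 <= x < 1)%R ->
    (0 <= Num.max x (Num.min (2 * x - s) ((x + t) / 2)) < 1)%R.
  by rewrite insubdK//; exact: bnd (valP u).
move=> /andP[? ?]; apply/andP.
by case: (leP (2 * _ - s)%R) => ?; case: (leP x) => ?; split; lra.
Qed.

Lemma val_bump_down u : val (bump_down s t u) =
  Num.min (val u) (Num.max ((val u + s) / 2) (2 * val u - t))%R.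
Proof.
have [s0 [st t1]] := stI.
suff bnd (x : R) : (0 <= x < 1)%R ->
    (0 <= Num.min x (Num.max ((x + s) / 2) (2 * x - t)) < 1)%R.
  by rewrite insubdK//; exact: bnd (valP u).
move=> /andP[? ?]; apply/andP.
by case: (leP ((_ + s) / 2)%R) => ?; case: (leP x) => ?; split; lra.
Qed.

Lemma bump_upK : cancel (bump_up s t) (bump_down s t).
Proof.
have [s0 [st t1]] := stI.
move=> u; apply: val_inj; rewrite val_bump_down; move: (val_bump_up u).
case: (leP (2 * _ - s)%R) => ?; case: (leP (val u)) => ? ->;
by case: (leP ((_ + s) / 2)%R) => ?; case: leP => ?; lra.
Qed.

Lemma bump_downK : cancel (bump_down s t) (bump_up s t).
Proof.
have [s0 [st t1]] := stI.
move=> u; apply: val_inj; rewrite val_bump_up; move: (val_bump_down u).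
case: (leP ((_ + s) / 2)%R) => ?; case: (leP (val u)) => ? ->;
by case: (leP (2 * _ - s)%R) => ?; case: leP => ?; lra.
Qed.

Lemma bump_up_homo : {homo bump_up s t : u u' / u <= u'}.
Proof.
have [s0 [st t1]] := stI.
move=> u u'; rewrite !leEsub !val_bump_up; move: (val u) (val u') => x x' xx'.
case: (leP (2 * x - s) ((x + t) / 2))%R => ?; case: (leP x) => ?;
by case: (leP (2 * x' - s) ((x' + t) / 2))%R => ?; case: (leP x') => ?; lra.
Qed.

Lemma bump_down_homo : {homo bump_down s t : u u' / u <= u'}.
Proof.
have [s0 [st t1]] := stI.
move=> u u'; rewrite !leEsub !val_bump_down; move: (val u) (val u') => x x' xx'.
case: (leP ((x + s) / 2) (2 * x - t))%R => ?; case: (leP x) => ?;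
by case: (leP ((x' + s) / 2) (2 * x' - t))%R => ?; case: (leP x') => ?; lra.
Qed.

(** Left of [s] the line of slope 2 is below the diagonal, right of [t] the line of slope 1/2 is, so
    the maximum is [val u]. *)
Lemma bump_up_fix u : ~~ (s < val u < t)%R -> bump_up s t u = u.
Proof.
have [s0 [st t1]] := stI.
rewrite negb_and -!leNgt => su; apply: val_inj; rewrite val_bump_up.
case/orP: su => ?;
by case: (leP (2 * _ - s)%R) => ?; case: (leP (val u)) => ?; lra.
Qed.

Lemma bump_up_gt u : (s < val u < t)%R -> (val u < val (bump_up s t u))%R.
Proof.
have [s0 [st t1]] := stI.
move=> /andP[su ut]; rewrite val_bump_up.
by case: (leP (2 * _ - s)%R) => ?; case: (leP (val u)) => ?; lra.
Qed.

Lemma on_fiber_bump_homeomorphism w : homeomorphism (on_fiber w (bump_up s t)).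
Proof.
apply: (@order_iso_homeomorphism _ _ _ (on_fiber w (bump_down s t))).
- by apply: on_fiber_homo; exact: bump_up_homo.
- by apply: on_fiber_homo; exact: bump_down_homo.
- by apply: on_fiberK; exact: bump_upK.
- by apply: on_fiberK; exact: bump_downK.
Qed.

End Bump.

(* Two bumps with the same left end and different right ends do not commute:
   the shorter one fixes its right end, which the longer one moves. *)
Lemma long_line_rich d (W : orderType d) (R : realType) (x y : X W R) :
  x < y -> exists h k : X W R -> X W R,
  [/\ homeomorphism h /\ {homo h : z z' / z <= z'},
      homeomorphism k /\ {homo k : z z' / z <= z'},
      h \o k <> k \o h,
      forall z, ~~ (x < z < y) -> h z = z
    & forall z, ~~ (x < z < y) -> k z = z].
Proof.
move=> /long_line_fiber_in_itv[w [s [t [s0 st t1 itv]]]].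
pose m := ((s + t) / 2)%R.
have mE : (m + m = s + t)%R by rewrite /m; lra.
move: m mE => m mE; have sm : (s < m)%R by lra.
have mt : (m < t)%R by lra.
have m01 : (0 <= m < 1)%R by apply/andP; split; lra.
pose um : unit_Ico R := Sub m m01.
have stI : (0 <= s /\ s < t /\ t <= 1)%R by [].
have smI : (0 <= s /\ s < m /\ m <= 1)%R by do 2?split => //; lra.
have fix_off r : (0 <= s /\ s < r /\ r <= 1)%R -> (r <= t)%R ->
    forall z : X W R, ~~ (x < z < y) ->
    on_fiber w (bump_up s r) z = z.
  move=> srI rt [[v u]|] //= nz; case: eqP => // vw; subst v.
  rewrite (bump_up_fix srI)//; apply: contra nz => /andP[su ur].
  by apply: itv; rewrite su (lt_le_trans ur).
exists (on_fiber w (bump_up s t)), (on_fiber w (bump_up s m)); split.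
- split; first exact: on_fiber_bump_homeomorphism.
  by apply: on_fiber_homo; exact: bump_up_homo.
- split; first exact: on_fiber_bump_homeomorphism.
  by apply: on_fiber_homo; exact: bump_up_homo.
(* The long bump sends [u] to [m], which the short one fixes. Commutation at [u] and injectivity of
   the long bump would make the short one fix [u], although [s < u < m]. *)
- move=> hk; pose u := bump_down s t um.
  have /andP[su um'] : (s < val u < m)%R.
    (* Since [2 * m - t = s], the value of [u] is [(m + s) / 2]. *)
    rewrite /u val_bump_down// SubK; apply/andP.
    by rewrite max_l ?min_r; [split| |]; lra.
  have := congr1 (fun f => f (Some (w, u))) hk.
  rewrite /= eqxx bump_downK//.
  rewrite [bump_up s m um](bump_up_fix smI) ?SubK ?ltxx ?andbF//.
  move=> -[] /(congr1 (bump_down s t)); rewrite bump_upK// -/u => uE.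
  have : (s < val u < m)%R by rewrite su.
  by move=> /(bump_up_gt smI); rewrite uE ltxx.
- exact: fix_off.
- by apply: fix_off => //; exact: ltW.
Qed.

(** * Monotonicity from a fixed greatest point *)

Lemma order_nbhs_right d (X : orderTopologicalType d) (P : set X) (p m : X) :
  p < m -> nbhs p P -> exists2 b, p < b & forall y, p <= y < b -> P y.
Proof.
move=> pm; rewrite itv_nbhsE => -[[l r] [io pi] iP].
(* A finite right end serves as [b]; if the interval is unbounded on the right, [m] does. *)
have [b pb ib] : exists2 b, p < b & forall y, y < b -> BRight y <= r.
  case: r io pi {iP} => [[] r|[]]; rewrite /itv_open_ends ?orbF ?andbF//=.
  - by rewrite itv_boundlr bnd_simp => _ /andP[_ pr]; exists r.
  - by case: l => [[]|[]].
  - by move=> _ /andP[].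
  - by exists m.
exists b => // y /andP[py yb]; apply: iP => /=.
move: pi; rewrite !itv_boundlr => /andP[lp _]; rewrite ib// andbT.
by apply: le_trans lp _; rewrite bnd_simp.
Qed.

(** A supremum argument: if [x < y] and [f y < f x], let [z] be the last point from [y] on with
    [f z <= f x]. Injectivity makes this strict, and continuity then produces a later such point. *)
Lemma fix_top_order_preserving d (X : orderTopologicalType d) (m : X)
    (f : X -> X) :
  (forall x y : X, x < y -> exists2 z, x < z & z < y) ->
  (forall A : set X, A !=set0 -> supremums A !=set0) ->
  (forall x, x <= m) -> continuous f -> injective f -> f m = m ->
  {homo f : x y / x <= y}.
Proof.
move=> dense complete topm fc finj fm x y.
rewrite le_eqVlt => /predU1P[->//|xy]; rewrite leNgt; apply/negP => fyx.
have fxm : f x < m.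
  rewrite lt_neqAle topm andbT -fm (inj_eq finj).
  by apply: contraTneq xy => ->; rewrite -leNgt.
pose A := `[y, +oo[%classic `&` f @^-1` `]-oo, f x]%classic.
have Ay : A y by split; rewrite /= in_itv/= ?andbT ?lexx// ltW.
have [z zA] := complete A (ex_intro _ y Ay).
have cA : closed A.
  apply: closedI; first exact: rray_closed.
  by move/continuous_closedP: fc; apply; exact: lray_closed.
have [/= yz fzx] := itv_closed_supremums (ex_intro _ y Ay) cA zA.
rewrite in_itv /= andbT in yz; rewrite in_itv /= in fzx.
have fzx' : f z < f x.
  rewrite lt_neqAle fzx andbT (inj_eq finj).
  by apply: contraTneq xy => <-; rewrite -leNgt.
(* [z] is not [m], because [f m = m] cannot lie below [f x]; this leaves room to the right of
   [z]. *)
have zm : z < m.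
  rewrite lt_neqAle topm andbT; apply: contraTneq fzx' => ->.
  by rewrite fm -leNgt topm.
have [b zb bP] := order_nbhs_right zm (fc z _ (order_nbhs_lt fzx')).
have [u zu ub] := dense _ _ zb.
have := bP u; rewrite (ltW zu) ub => /(_ isT) /= fux.
have : u <= z.
  apply: zA.1; split; first by rewrite /= in_itv/= andbT (le_trans yz)// ltW.
  by rewrite /= in_itv/= ltW.
by rewrite leNgt zu.
Qed.

(** * Completeness of the long line and its top point *)

Lemma omega1_seq_bounded d (W : orderType d) (c : nat -> W) :
  is_omega1 W -> exists w, forall n, c n < w.
Proof.
move=> [_ ncW cW]; apply: contrapT => /forallNP unb; apply: ncW.
(* An unbounded sequence would cover [W] by countably many closed initial segments; the boolean
   index splits each into a countable open one and its end point. *)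
have -> : [set: W] =
    \bigcup_n \bigcup_b if b then [set x | x < c n] else [set c n].
  apply/seteqP; split=> // w _; have /existsNP[n /negP nw] := unb w.
  rewrite -leNgt le_eqVlt in nw; exists n => //.
  by case/orP: nw => [/eqP->|]; [exists false|exists true].
apply: bigcup_countable => // n _; apply: bigcup_countable => // -[] _.
  exact: cW.
exact: countable1.
Qed.

Section LongLine.
Context d (W : orderType d) (R : realType).

(** The supremum is found one coordinate at a time: the least first coordinate [w] of an upper
    bound, then the infimum of the second coordinates of upper bounds over [w]. It is the top if
    there is no other upper bound. *)
Lemma long_line_supremums (A : set (X W R)) :
  well_order (<=%O : rel W) -> A !=set0 -> supremums A !=set0.
Proof.
move=> woW _; pose P := [pred w | `[< exists u, ubound A (Some (w, u)) >]].
have [[w0 Pw0]|noP] := pselect (exists w, w \in P); last first.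
  exists None; split=> [a _|]; first exact: long_leT.
  move=> [[w u]|//] ubw; exfalso; apply: noP; exists w.
  by apply/asboolP; exists u.
have [w [[/asboolP[u0 ubu0] wmin] _]] := woW P (ex_intro _ w0 Pw0).
pose T := [set val u | u in [set u | ubound A (Some (w, u))]].
have T0 : T !=set0 by exists (val u0), u0.
have lbT : lbound T 0%R by move=> _ [u _ <-]; have /andP[] := valP u.
have T01 : (0 <= inf T < 1)%R.
  rewrite lb_le_inf//=; have /andP[_] := valP u0; apply: le_lt_trans.
  by apply: ge_inf; [exists 0%R|exists u0].
exists (Some (w, Sub (inf T) T01 : unit_Ico R)); split.
  move=> [[v s]|] As; last by have := ubu0 _ As.
  have := ubu0 _ As; rewrite !long_le => /orP[->//|/andP[/eqP vw _]].
  rewrite vw eqxx ltxx SubK /=; apply: lb_le_inf => // _ [u ubu <-].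
  by have := ubu _ As; rewrite long_le vw eqxx ltxx.
move=> [[v s]|] ubv; last exact: long_leT.
have := wmin v; rewrite inE => /(_ (ex_intro _ s ubv)).
rewrite long_le le_eqVlt => /orP[/eqP wv|->//].
rewrite wv eqxx ltxx SubK /=; apply: ge_inf; first by exists 0%R.
by exists s => //; rewrite wv.
Qed.

Lemma long_line_right_seq (p : X W R) : p < None ->
  exists q : nat -> X W R, (forall n, q n != p) /\
    forall b, p < b -> exists2 n, p <= q n & q n < b.
Proof.
case: p => [[w s]|]; last by rewrite ltxx.
(* [q] descends to [p] along its fibre; the finitely many terms that would leave the fibre are sent
   to the top, which is still above [p]. *)
move=> _; pose q n : X W R :=
  if insub (val s + n.+1%:R^-1)%R is Some u then Some (w, u) else None.
have qn n : (Some (w, s) : X W R) < q n.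
  rewrite /q; case: insubP => [u _ uE|_]; last exact: long_ltT.
  by rewrite long_lt eqxx uE ltrDl invr_gt0 ltr0n orbT.
exists q; split=> [n|b pb]; first by rewrite (gt_eqF (qn n)).
(* [r] is the height up to which the fibre stays below [b]: 1 if [b] is off the fibre, its second
   coordinate otherwise. *)
have below r : (val s < r)%R -> (r <= 1)%R ->
    (forall u, (val u < r)%R -> (Some (w, u) : X W R) < b) ->
    exists2 n, (Some (w, s) : X W R) <= q n & q n < b.
  move=> sr r1 rb; have [n nr] := ltr_add_invr sr.
  exists n; first exact/ltW/qn.
  have n01 : (0 <= val s + n.+1%:R^-1 < 1)%R.
    have /andP[s0 _] := valP s.
    by rewrite (lt_le_trans nr)// addr_ge0// invr_ge0 ler0n.
  by rewrite /q insubT; apply: rb; rewrite SubK.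
have /andP[s0 s1] := valP s.
case: b pb below => [[v t]|] pb below; last first.
  by apply: (below 1%R) => // u _; exact: long_ltT.
move: pb; rewrite long_lt => /orP[wv|/andP[/eqP wv st]].
  by apply: (below 1%R) => // u _; rewrite long_lt wv.
apply: (below (val t)) => //; first by have /andP[_ /ltW] := valP t.
by move=> u ut; rewrite long_lt wv eqxx ut orbT.
Qed.

(** Otherwise a sequence [q] of other points accumulates at [f None] from the right. The points
    [g (q n)] are below the top, hence bounded away from it by a countable supremum, against
    continuity of [g] at [f None]. *)
Lemma homeomorphism_fix_top (f : X W R -> X W R) :
  is_omega1 W -> homeomorphism f -> f None = None.
Proof.
move=> W1 [fc [g [gc fK gK]]]; apply/eqP; rewrite eq_le long_leT leNgt /=.
apply/negP => pT; have [q [qNp qp]] := long_line_right_seq pT.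
have gq n : g (q n) <> None.
  by move=> gqT; have := qNp n; rewrite -gqT gK eqxx.
(* [u0] is just some height in [0, 1), and [w0] a default value that [gq] rules out. *)
have [[w0 u0] _] : exists p, f None = Some p.
  by case: (f None) pT => [p|]; [exists p|rewrite ltxx].
pose c n := if g (q n) is Some (v, _) then v else w0.
have [w cw] := omega1_seq_bounded c W1.
have gqw n : g (q n) < (Some (w, u0) : X W R).
  have := cw n; rewrite /c; case: (g (q n)) (gq n) => [[v s] _ vw|//].
  by rewrite long_lt vw.
have near_top : (Some (w, u0) : X W R) < g (f None).
  by rewrite fK; exact: long_ltT.
have [b pb bP] := order_nbhs_right pT (gc _ _ (order_nbhs_gt near_top)).
have [n pq qb] := qp _ pb.
have := bP (q n); rewrite pq qb => /(_ isT) /=.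
by rewrite ltNge (ltW (gqw n)).
Qed.

Lemma long_line_order_preserving (f : X W R -> X W R) :
  is_omega1 W -> homeomorphism f -> {homo f : x y / x <= y}.
Proof.
move=> W1 fh; have [fc [g [_ fK _]]] := fh.
apply: (@fix_top_order_preserving _ (X W R) None f) => //.
- exact: long_line_dense.
- by move=> A; apply: long_line_supremums; case: W1.
- exact: long_leT.
- exact: can_inj fK.
- exact: homeomorphism_fix_top.
Qed.

(** Fullness of the action turns the non-commuting bumps into elements of [G]. *)
Lemma long_line_action_minimal (G : groupType) (e : G -> X W R -> X W R)
    (tau : Topological G) :
  e 1%g = id -> (forall g h, e (g * h)%g = e g \o e h) -> injective e ->
  (forall g, {homo e g : x y / x <= y}) ->
  (forall f, homeomorphism f -> {homo f : x y / x <= y} ->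
    exists g, e g = f) ->
  (forall A : set (Topological.Pack tau), open A <->
    exists2 B : set {compact-open, X W R -> X W R}, open B & e @^-1` B = A) ->
  hausdorff_group_topology tau /\
  forall sigma : Topological G, hausdorff_group_topology sigma ->
    @open (Topological.Pack tau) `<=` @open (Topological.Pack sigma).
Proof.
move=> e1 eM e_inj e_mono e_full; apply: order_action_minimal => //.
  exact: long_line_dense.
move=> p q /long_line_rich[h [k [[hh hm] [kh km] hk hfix kfix]]].
have [[h' hE] [k' kE]] := (e_full h hh hm, e_full k kh km).
exists h', k'; rewrite hE kE; split=> // hk'; apply: hk.
by rewrite -hE -kE -!eM hk'.
Qed.

End LongLine.

Theorem mainTheorem5 (d : Order.disp_t) (W : orderType d) (R : realType)
    (W_omega1 : is_omega1 W) :
  a_minimal (order_homeo (extended_long_line W R)) /\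
  a_minimal (homeo (extended_long_line W R)).
Proof.
split.
  apply: (@long_line_action_minimal _ W R _
    (fun g : order_homeo (X W R) => homeo_fun (order_homeo_val g))) => //.
  - by move=> g h /val_inj /val_inj.
  - by move=> g; have /asboolP := order_homeo_subproof g.
  - move=> f fh fm; pose h := Homeo (asboolT fh).
    by exists (OrderHomeo (asboolT fm : order_preserving h)).
  (* The topology of the subgroup is initial in two stages, so its open sets are double
     preimages. *)
  - move=> A; split=> [[_ [B oB <-] <-]|[B oB <-]]; first by exists B.
    by exists (@homeo_fun (X W R) @^-1` B) => //; exists B.
apply: (@long_line_action_minimal _ W R _ (@homeo_fun (X W R))) => //.
- exact: val_inj.
(* Here [is_omega1 W] enters: every homeomorphism preserves the order. *)
- by move=> g; apply: long_line_order_preserving => //; exact: homeoP.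
- by move=> f fh _; exists (Homeo (asboolT fh)).
Qed.
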